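(* For any finite digraph $(\mathsf V,\mathsf E)$, the least number of hubs in a hub extension of $(\mathsf V,\mathsf E)$ equals the biclique cover number of $(\mathsf V,\mathsf E)$.
   Context: A digraph $(\mathsf V,\mathsf E)$ consists of a vertex set $\mathsf V$ and an edge set $\mathsf E\subseteq\mathsf V\times\mathsf V$. A biclique of $(\mathsf V,\mathsf E)$ is a pair $A,B\subseteq\mathsf V$ with $A\times B\subseteq\mathsf E$. The biclique cover number of $(\mathsf V,\mathsf E)$ is the least number of bicliques such that the union of the corresponding sets $A\times B$ is $\mathsf E$. A hub extension of $(\mathsf V,\mathsf E)$ is a digraph $(\widetilde{\mathsf V},\widetilde{\mathsf E})$ with a finite hub set $H$ disjoint from $\mathsf V$ and $\widetilde{\mathsf V}=\mathsf V\cup H$, such that 1. for $a,b\in\mathsf V$: $(a,b)\in\mathsf E$ if and only if there is a hub $h\in H$ with $(a,h),(h,b)\in\widetilde{\mathsf E}$; and 2. every edge of $\widetilde{\mathsf E}$ has the form $(a,h)$ or $(h,a)$ for some $h\in H$ and $a\in\mathsf V$. The number of hubs is $|H|$. *)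

(* Defs.v *)
From mathcomp Require Import all_boot.
Set Implicit Arguments.
Unset Strict Implicit.
Unset Printing Implicit Defensive.

(* A finite digraph is a vertex type V : finType with its edge set
   E : {set V * V}; loops and antiparallel edges are allowed. *)

Definition is_least (P : nat -> Prop) (n : nat) : Prop :=
  P n /\ forall m, P m -> n <= m.

(* A and B may overlap, and either of them may be empty. *)
Definition biclique (V : finType) (E : {set V * V})
    (AB : {set V} * {set V}) : bool :=
  setX AB.1 AB.2 \subset E.

Definition biclique_cover (V : finType) (E : {set V * V})
    (C : {set {set V} * {set V}}) : bool :=
  [forall AB in C, biclique E AB] && (\bigcup_(AB in C) setX AB.1 AB.2 == E).

(* The family of all bicliques is only the seed required by arg min; it is
   always a cover, see biclique_cover_all. *)
Definition biclique_cover_number (V : finType) (E : {set V * V}) : nat :=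
  #|[arg min_(C < [set AB | biclique E AB] | biclique_cover E C) #|C|]|.

Lemma biclique_cover_all (V : finType) (E : {set V * V}) :
  biclique_cover E [set AB | biclique E AB].
Proof.
apply/andP; split; first by apply/forall_inP => AB; rewrite inE.
rewrite eqEsubset; apply/andP; split.
  by apply/bigcupsP => AB; rewrite inE.
apply/subsetP => -[a b] abE; apply/bigcupP; exists ([set a], [set b]).
  rewrite inE; apply/subsetP => -[x y] /setXP[/set1P-> /set1P->] //.
by apply/setXP; rewrite !set11.
Qed.

Lemma biclique_cover_numberP (V : finType) (E : {set V * V}) :
  is_least
    (fun k => exists C : {set {set V} * {set V}}, biclique_cover E C /\ #|C| = k)
    (biclique_cover_number E).
Proof.
rewrite /biclique_cover_number; case: arg_minnP.
  exact: biclique_cover_all.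
by move=> C coverC minC; split=> [|_ [D [coverD <-]]]; [exists C | apply: minC].
Qed.

(* The hub set is a type H, and the disjoint union of V and H is V + H. *)
Definition hub_extension (V H : finType) (E : {set V * V})
    (E' : {set (V + H) * (V + H)}) : Prop :=
  (forall a b : V,
     (a, b) \in E <->
     exists h : H, (inl a, inr h) \in E' /\ (inr h, inl b) \in E') /\
  (forall e, e \in E' ->
     exists (h : H) (a : V), e = (inl a, inr h) \/ e = (inr h, inl a)).

Definition has_hub_extension (V : finType) (E : {set V * V}) (k : nat) : Prop :=
  exists (H : finType) (E' : {set (V + H) * (V + H)}),
    hub_extension E E' /\ #|H| = k.

(* Main.v *)
Require Import Defs.
From mathcomp Require Import all_boot.
Set Implicit Arguments.
Unset Strict Implicit.
Unset Printing Implicit Defensive.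

(** A hub [h] and a biclique [(A, B)] carry the same information: [A] is the
    set of in-neighbours of [h] and [B] its set of out-neighbours.  The first
    condition on a hub extension then says exactly that the bicliques of the
    hubs cover [E].  Hence a cover [C] yields a hub extension with hub set [C]
    ([biclique_cover_hub_extension]), and a hub extension yields a cover with
    at most as many bicliques as hubs ([hub_extension_biclique_cover]); there
    may be fewer, since distinct hubs may have the same neighbourhoods. *)

(** The covering condition implies that each member of [C] is a biclique, so a
    cover is characterized edge by edge. *)
Lemma biclique_coverP (V : finType) (E : {set V * V})
    (C : {set {set V} * {set V}}) :
  biclique_cover E C <->
  forall a b, (a, b) \in E <->
    exists2 AB, AB \in C & (a \in AB.1) && (b \in AB.2).
Proof.
split=> [/andP[_ /eqP <-] a b | coverE].
  by split=> [/bigcupP[AB ABC] | [AB ABC abAB]];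
    [rewrite in_setX; exists AB | apply/bigcupP; exists AB; rewrite ?in_setX].
apply/andP; split.
  apply/forall_inP => AB ABC; apply/subsetP => -[a b]; rewrite in_setX => abAB.
  by apply/coverE; exists AB.
apply/eqP/setP => -[a b]; apply/bigcupP/idP => [[AB ABC] | /coverE[AB ABC abAB]].
  by rewrite in_setX => abAB; apply/coverE; exists AB.
by exists AB; rewrite ?in_setX.
Qed.

(** The edges between [V] and a hub set [H] determined by a pair of vertex sets
    [f h = (A, B)] for each hub [h], which receives an edge from each vertex of
    [A] and sends one to each vertex of [B]. *)
Definition hub_edges (V H : finType) (f : H -> {set V} * {set V}) :
    {set (V + H) * (V + H)} :=
  [set e : (V + H) * (V + H) | match e with
                               | (inl a, inr h) => a \in (f h).1
                               | (inr h, inl b) => b \in (f h).2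
                               | _ => false
                               end].

Lemma biclique_cover_hub_extension (V : finType) (E : {set V * V})
    (C : {set {set V} * {set V}}) :
  biclique_cover E C -> hub_extension E (hub_edges (fun h : {AB | AB \in C} => val h)).
Proof.
move=> /biclique_coverP coverE; split=> [a b | [[a | h] [b | h']]].
- apply: iff_trans (coverE a b) _; split=> [[AB ABC /andP[aA bB]] | [h]].
    by exists (exist _ AB ABC); rewrite !inE.
  by rewrite !inE => -[aA bB]; exists (val h); [exact: valP | rewrite aA].
- by rewrite inE.
- by exists h', a; left.
- by exists h, b; right.
- by rewrite inE.
Qed.

(** The in-neighbours and the out-neighbours of the hub [h]. *)
Definition hub_biclique (V H : finType) (E' : {set (V + H) * (V + H)}) (h : H) :
    {set V} * {set V} :=
  ([set a | (inl a, inr h) \in E'], [set b | (inr h, inl b) \in E']).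

Lemma hub_extension_biclique_cover (V H : finType) (E : {set V * V})
    (E' : {set (V + H) * (V + H)}) :
  hub_extension E E' -> biclique_cover E [set hub_biclique E' h | h : H].
Proof.
case=> hubE _; apply/biclique_coverP => a b.
apply: iff_trans (hubE a b) _; split=> [[h [ah hb]] | [_ /imsetP[h _ ->]]].
  by exists (hub_biclique E' h); [exact: imset_f | rewrite !inE ah].
by rewrite !inE => /andP[ah hb]; exists h.
Qed.

Theorem lemma2p1 (V : finType) (E : {set V * V}) :
  is_least (has_hub_extension E) (biclique_cover_number E).
Proof.
have [[C [coverC <-]] minC] := biclique_cover_numberP E.
split=> [|_ [H [E' [hubE' <-]]]].
  exists {AB | AB \in C}, (hub_edges (fun h => val h)); split.
    exact: biclique_cover_hub_extension.
  by rewrite card_sig; apply: eq_card => AB; rewrite inE.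
apply: leq_trans (leq_imset_card (hub_biclique E') H).
by apply: minC; eexists; split; first exact: hub_extension_biclique_cover hubE'.
Qed.
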